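(* Let $\alpha$ be a Perron number of degree $r$, with conjugates $\alpha_1=\alpha,\alpha_2,\dots,\alpha_r$. If the module of relations $\mathcal{R}_\alpha$ is trivial, then the pole enumeration map $\iota:\mathbb{N}_0^{r-1}\to\Omega_0$, $\kappa\mapsto s_\kappa$, for the zeta function associated to an integer linear recurrence sequence satisfying the minimal polynomial of $\alpha$, is injective. Furthermore, if $\alpha$ is a unit (in the ring of algebraic integers), this is an equivalence: $\mathcal{R}_\alpha$ is trivial if and only if $\iota$ is injective.
   Context: $\mathbb{N}_0=\{0,1,2,\dots\}$. A Perron number is a real algebraic integer $\alpha>1$ such that all of its other conjugates are strictly smaller than $\alpha$ in modulus. The degree and conjugates are taken over $\mathbb{Q}$. For a multi-index $\kappa=(\kappa_2,\dots,\kappa_r)\in\mathbb{N}_0^{r-1}$ (indexed from $2$ to $r$), put $|\kappa|=\kappa_2+\dots+\kappa_r$ and $$s_\kappa=-|\kappa|+\frac{\log|\alpha_2^{\kappa_2}\cdots\alpha_r^{\kappa_r}|}{\log\alpha}+i\,\frac{\arg(\alpha_2^{\kappa_2}\cdots\alpha_r^{\kappa_r})}{\log\alpha},$$ where $\arg$ is the principal argument with values in $(-\pi,\pi]$. Let $\Omega_0=\{s\in\mathbb{C} : -\frac{\pi}{\log\alpha}<\Im(s)\le\frac{\pi}{\log\alpha}\}$. The pole enumeration map (indexation map) is $\iota:\mathbb{N}_0^{r-1}\to\Omega_0$, $\iota(\kappa)=s_\kappa$. It depends only on $\alpha$ and the numbering of its conjugates. Relation with the zeta function: if $\{a_n\}$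 is an integer linear recurrence sequence satisfying the minimal polynomial of $\alpha$, written $a_n=\lambda_1\alpha_1^n+\dots+\lambda_r\alpha_r^n$ with $\lambda_1>0$ (discarding, if necessary, a finite number of terms), the associated zeta function $\varphi(s)$ is the meromorphic continuation of $\sum_{n\ge1}a_n^{-s}$, and its poles lie among the points $s_\kappa+\frac{2\pi i n}{\log\alpha}$ with $\kappa\in\mathbb{N}_0^{r-1}$, $n\in\mathbb{Z}$. The module of relations of $\alpha$ is $\mathcal{R}_\alpha=\{(m_1,\dots,m_r)\in\mathbb{Z}^r : \alpha_1^{m_1}\cdots\alpha_r^{m_r}=1\}$. It is called trivial if $\mathcal{R}_\alpha\subseteq\langle e\rangle=\mathbb{Z}e$, where $e=(1,\dots,1)\in\mathbb{Z}^r$, i.e. if every multiplicative relation between the conjugates has all exponents equal. *)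

(* Defs.v *)
From mathcomp Require Import all_boot all_order all_algebra.
From mathcomp Require Import all_classical all_reals all_analysis.
From mathcomp Require Export complex.

Set Implicit Arguments.
Unset Strict Implicit.
Unset Printing Implicit Defensive.

Import Order.TTheory GRing.Theory Num.Theory.

Local Open Scope classical_set_scope.
Local Open Scope ring_scope.
Local Open Scope complex_scope.

Section ComplexNumbers.
Variable R : realType.
Implicit Types z x y : R[i].

Definition cmod z : R := ComplexField.Normc.normc z.

(* Principal argument, with values in ]-pi, pi]; see cargP. The value at 0 is
   junk. *)
Definition carg z : R :=
  if 0 <= complex.Im z then acos (complex.Re z / cmod z)
  else - acos (complex.Re z / cmod z).

Definition algebraic_integer z : Prop :=
  integralOver (fun m : int => m%:~R : R[i]) z.

Definition algebraic_unit z : Prop :=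
  z != 0 /\ algebraic_integer z /\ algebraic_integer z^-1.

Definition is_minpoly z (p : {poly rat}) : Prop :=
  [/\ p \is monic, irreducible_poly p & root (map_poly ratr p) z].

Definition has_degree z (r : nat) : Prop :=
  exists2 p : {poly rat}, is_minpoly z p & size p = r.+1.

Definition conjugate_of z : set R[i] :=
  [set y | exists2 p : {poly rat}, is_minpoly z p & root (map_poly ratr p) y].

Definition perron (alpha : R) : Prop :=
  [/\ algebraic_integer alpha%:C, 1 < alpha &
      forall z, conjugate_of alpha%:C z -> z != alpha%:C -> cmod z < alpha].

(* For alpha of degree r = n.+1, its conjugates alpha_1 = alpha, ..., alpha_r are
   a ord0, ..., a ord_max. *)
Definition conjugate_numbering n (alpha : R) (a : 'I_n.+1 -> R[i]) : Prop :=
  [/\ injective a, range a = conjugate_of alpha%:C & a ord0 = alpha%:C].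

Definition relation_module r (a : 'I_r -> R[i]) : set 'rV[int]_r :=
  [set m | \prod_(i < r) a i ^ m ord0 i = 1].

Definition trivial_relations r (a : 'I_r -> R[i]) : Prop :=
  relation_module a `<=` [set (const_mx 1 : 'rV[int]_r) *~ k | k in [set: int]].

Definition Omega0 (alpha : R) : set R[i] :=
  [set s | - (pi / ln alpha) < complex.Im s <= pi / ln alpha].

(* A multi-index (kappa_2, ..., kappa_r) is a function on 'I_n with r = n.+1:
   kappa_j is k (j - 2), the exponent of alpha_j = a (lift ord0 (j - 2)). *)
Definition pole n (alpha : R) (a : 'I_n.+1 -> R[i]) (k : {ffun 'I_n -> nat}) :
    R[i] :=
  let z := \prod_(j < n) a (lift ord0 j) ^+ k j in
  (- (\sum_(j < n) k j)%N%:R + ln (cmod z) / ln alpha) +i* (carg z / ln alpha).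

Lemma cmodE z : cmod z = Num.sqrt (complex.Re z ^+ 2 + complex.Im z ^+ 2).
Proof. by case: z. Qed.

Lemma cmod_ge0 z : 0 <= cmod z.
Proof. by rewrite cmodE sqrtr_ge0. Qed.

Lemma Re_cmod_itv z : -1 <= complex.Re z / cmod z <= 1.
Proof.
rewrite -ler_norml normrM normfV (ger0_norm (cmod_ge0 z)).
have [->|z0] := eqVneq (cmod z) 0; first by rewrite invr0 mulr0.
rewrite ler_pdivrMr ?mul1r; last by rewrite lt_neqAle eq_sym z0 cmod_ge0.
by rewrite cmodE -sqrtr_sqr ler_sqrt ?lerDl ?sqr_ge0 // addr_ge0 ?sqr_ge0.
Qed.

Lemma carg_itv z : - pi < carg z <= pi.
Proof.
have xB := Re_cmod_itv z; rewrite /carg; case: (leP 0 (complex.Im z)) => Imz.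
  by rewrite acos_lepi // andbT (lt_le_trans _ (acos_ge0 xB)) // oppr_lt0 pi_gt0.
have z0 : 0 < cmod z.
  by rewrite cmodE sqrtr_gt0 ltr_wpDl ?sqr_ge0 // exprn_even_gt0 //= lt_eqF.
rewrite ltrN2 acos_ltpi ?(le_trans _ (pi_ge0 R)) ?oppr_le0 ?acos_ge0 //.
have /andP[_ ->] := xB; rewrite andbT ltr_pdivlMr // mulN1r ltrNl.
rewrite (le_lt_trans (ler_norm _)) // normrN cmodE -sqrtr_sqr ltr_sqrt.
  by rewrite ltrDl exprn_even_gt0 //= lt_eqF.
by rewrite ltr_wpDl ?sqr_ge0 // exprn_even_gt0 //= lt_eqF.
Qed.

Lemma cargP z : z = (cmod z)%:C * (cos (carg z) +i* sin (carg z)).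
Proof.
have xB := Re_cmod_itv z.
have [z0|z0] := eqVneq (cmod z) 0.
  by rewrite z0 mul0r; exact: ComplexField.Normc.eq0_normc.
have cE : cos (carg z) = complex.Re z / cmod z.
  by rewrite /carg; case: ifP => _; rewrite ?cosN acosK // in_itv.
have sE : Num.sqrt (1 - (complex.Re z / cmod z) ^+ 2) = `|complex.Im z| / cmod z.
  have mE : cmod z ^+ 2 = complex.Re z ^+ 2 + complex.Im z ^+ 2.
    by rewrite cmodE sqr_sqrtr // addr_ge0 ?sqr_ge0.
  have -> : 1 - (complex.Re z / cmod z) ^+ 2 = (complex.Im z / cmod z) ^+ 2.
    rewrite !expr_div_n -[1](@divff _ (cmod z ^+ 2)) ?expf_neq0 //.
    by rewrite -mulrBl mE addrC addKr.
  by rewrite sqrtr_sqr normrM normfV (ger0_norm (cmod_ge0 z)).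
have sinE : sin (carg z) = complex.Im z / cmod z.
  rewrite /carg; case: (leP 0 (complex.Im z)) => Imz; rewrite ?sinN sin_acos // sE.
    by rewrite ger0_norm.
  by rewrite ltr0_norm // mulNr opprK.
rewrite cE sinE; case: z z0 {xB cE sE sinE} => x y z0.
by apply/eqP; rewrite eq_complex /= !mul0r subr0 addr0 ![_ * (_ / _)]mulrC !divfK ?eqxx.
Qed.

Lemma pole_Omega0 n (alpha : R) (a : 'I_n.+1 -> R[i]) (k : {ffun 'I_n -> nat}) :
  1 < alpha -> Omega0 alpha (pole alpha a k).
Proof.
move=> alpha1; rewrite /Omega0 /pole /= -mulNr.
have l0 : 0 < (ln alpha)^-1 by rewrite invr_gt0 ln_gt0.
by rewrite ltr_pM2r // ler_pM2r // carg_itv.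
Qed.

Lemma perron_gt1 (alpha : R) : perron alpha -> 1 < alpha.
Proof. by case. Qed.

Definition pole_enumeration n (alpha : R) (palpha : perron alpha)
    (a : 'I_n.+1 -> R[i]) (k : {ffun 'I_n -> nat}) : Omega0 alpha :=
  SigSub (mem_set (pole_Omega0 a k (perron_gt1 palpha))).

End ComplexNumbers.

(* Main.v *)
Require Import Defs.
From mathcomp Require Import all_boot all_order all_algebra.
From mathcomp Require Import all_classical all_reals all_analysis.
From mathcomp Require Import complex.
From mathcomp Require Import lra zify.

(* Two poles s_k, s_k' coincide iff z_k / alpha^|k| = z_k' / alpha^|k'| with
   z_k = prod_j alpha_j^k_j, i.e. iff (|k'| - |k|, k_2 - k'_2, ...) is a
   multiplicative relation. The exponents of such a relation sum to 0, so if it is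
   a multiple of (1, ..., 1) it vanishes. Conversely, splitting exponents into
   positive and negative parts, every relation with sum 0 arises in this way. If
   alpha is a unit, the product of its conjugates is 1 or -1, so that a nontrivial
   relation can be corrected into a nonzero one with sum 0. *)

Set Implicit Arguments.
Unset Strict Implicit.
Unset Printing Implicit Defensive.

Import Order.TTheory GRing.Theory Num.Theory.

Local Open Scope classical_set_scope.
Local Open Scope ring_scope.
Local Open Scope complex_scope.

(** * Integer units and reciprocal polynomials *)

Lemma sqr_eq1_of_mul_eq1 (x y : int) : x * y = 1 -> x ^+ 2 = 1.
Proof.
by rewrite mulrC => /intUnitRing.unitzPl; rewrite qualifE -sqrf_eq1 => /eqP.
Qed.

(** The reciprocal polynomial X^(deg q) q(1/X): it turns a monic equation for 1/z into an equation
    for z with constant coefficient 1. *)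
Definition rev_poly (A : nzRingType) (q : {poly A}) : {poly A} :=
  \poly_(i < size q) q`_(size q - i.+1).

Lemma coef0_rev_poly (A : nzRingType) (q : {poly A}) :
  (rev_poly q)`_0 = lead_coef q.
Proof.
rewrite coef_poly lead_coefE subn1; case: ltnP => //.
by rewrite leqn0 size_poly_eq0 => /eqP ->; rewrite coef0.
Qed.

Lemma root_map_rev_poly (A : nzRingType) (F : fieldType)
    (f : {rmorphism A -> F}) (q : {poly A}) (z : F) : z != 0 ->
  root (map_poly f q) z^-1 -> root (map_poly f (rev_poly q)) z.
Proof.
move=> z0 /rootP q0; apply/rootP.
(* The reversed polynomial is shorter than [q] when [q] has constant coefficient 0, so both values
   are written as sums of [size q] terms. *)
rewrite (@horner_coef_wide _ (size q)); last first.
  exact: leq_trans (size_poly _ _) (size_poly _ _).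
rewrite (@horner_coef_wide _ (size q)) in q0; last exact: size_poly.
(* Multiply q(1/z) = 0 by z^(deg q), then reverse the order of summation. *)
move/(congr1 ( *%R (z ^+ (size q).-1))): q0; rewrite mulr0 mulr_sumr.
apply: etrans.
rewrite [RHS](reindex_inj rev_ord_inj) /=; apply: eq_bigr => i _.
rewrite !coef_map coef_poly ltn_ord /= mulrCA; congr (_ * _).
rewrite exprVn -expfB_cond; first by congr (_ ^+ _); have := ltn_ord i; lia.
by rewrite (negPf z0); have := ltn_ord i; lia.
Qed.

(** * Coincidence of poles as a multiplicative relation *)

Section Argument.
Variable R : realType.
Implicit Types (z : R[i]) (c : R).

Lemma cmodMr c z : 0 < c -> cmod (c%:C * z) = c * cmod z.
Proof.
move=> c0; rewrite /cmod ComplexField.Normc.normcM /= expr0n addr0.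
by rewrite sqrtr_sqr gtr0_norm.
Qed.

Lemma cargMr c z : 0 < c -> carg (c%:C * z) = carg z.
Proof.
move=> c0; rewrite /carg cmodMr //.
have -> : complex.Im (c%:C * z) = c * complex.Im z.
  by case: z => x y /=; rewrite mul0r addr0.
have -> : complex.Re (c%:C * z) = c * complex.Re z.
  by case: z => x y /=; rewrite mul0r subr0.
by rewrite pmulr_rge0 // -mulf_div divff ?gt_eqF // mul1r.
Qed.

Lemma cmod_gt0 z : z != 0 -> 0 < cmod z.
Proof.
move=> z0; rewrite lt_neqAle cmod_ge0 andbT eq_sym.
by apply: contra_neq z0; exact: ComplexField.Normc.eq0_normc.
Qed.

Section Poles.
Variables (n : nat) (alpha : R) (a : 'I_n.+1 -> R[i]).
Hypotheses (alpha1 : 1 < alpha) (a_neq0 : forall i, a i != 0).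

Let prod_conj_neq0 (k : {ffun 'I_n -> nat}) :
  \prod_(j < n) a (lift ord0 j) ^+ k j != 0.
Proof. by apply/prodf_neq0 => j _; rewrite expf_neq0. Qed.

(** Since [alpha] is positive, a factor [alpha ^+ l] keeps the principal argument and adds
    [l * ln alpha] to the logarithm of the modulus. Real and imaginary parts of the poles thus
    compare the moduli and the arguments of the two sides, which determine them by polar form. *)
Lemma pole_eqP (k k' : {ffun 'I_n -> nat}) :
  pole alpha a k = pole alpha a k' <->
  alpha%:C ^+ (\sum_j k' j) * \prod_(j < n) a (lift ord0 j) ^+ k j =
  alpha%:C ^+ (\sum_j k j) * \prod_(j < n) a (lift ord0 j) ^+ k' j.
Proof.
have alpha0 : 0 < alpha by apply: lt_trans alpha1.
have lnalpha : ln alpha != 0 by rewrite gt_eqF ?ln_gt0.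
have alphaXC m : alpha%:C ^+ m = (alpha ^+ m)%:C by rewrite rmorphXn.
have alphaX m : 0 < alpha ^+ m by rewrite exprn_gt0.
rewrite !alphaXC /pole.
move: (prod_conj_neq0 k) (prod_conj_neq0 k').
set z := \prod_j _; set z' := \prod_j _ => /cmod_gt0 z0 /cmod_gt0 z0'.
set m := (\sum_j k j)%N; set m' := (\sum_j k' j)%N.
have lnE l w : 0 < cmod w ->
    ln (cmod ((alpha ^+ l)%:C * w)) = l%:R * ln alpha + ln (cmod w).
  by move=> w0; rewrite cmodMr // lnM ?posrE // lnXn // mulr_natl.
split=> [[E /(mulIf (invr_neq0 lnalpha)) argE] | E].
  rewrite [LHS]cargP [RHS]cargP !cargMr // argE; congr (_%:C * _).
  apply: ln_inj; rewrite ?posrE ?cmodMr ?mulr_gt0 // -!cmodMr // !lnE //.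
  have /(congr1 ( *%R^~ (ln alpha))) := E.
  rewrite !mulrDl !divfK // => {}E; lra.
have argE : carg z = carg z' by rewrite -(cargMr _ (alphaX m')) E cargMr.
have := congr1 (fun w => ln (cmod w)) E; rewrite /= !lnE // => {}E.
apply/eqP; rewrite eq_complex /= argE eqxx andbT; apply/eqP.
apply: (mulIf lnalpha); rewrite !mulrDl !divfK //; lra.
Qed.

Lemma pole_eq_relation (k k' : {ffun 'I_n -> nat}) : a ord0 = alpha%:C ->
  pole alpha a k = pole alpha a k' <->
  relation_module a
    (\row_i if unlift ord0 i is Some j then (k j)%:Z - (k' j)%:Z
            else (\sum_j k' j)%N%:Z - (\sum_j k j)%N%:Z).
Proof.
move=> a0; rewrite pole_eqP /relation_module /=.
have expzB i (x y : nat) : a i ^ (x%:Z - y%:Z) = a i ^+ x / a i ^+ y.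
  by rewrite expfzDr // -invr_expz.
rewrite big_ord_recl mxE unlift_none expzB a0.
under [X in _ <-> _ * X = 1]eq_bigr do rewrite mxE liftK expzB.
rewrite prodf_div mulf_div; apply: rwP2 (eqP) _; apply: (iffP eqP) => [->|].
  by rewrite divff // mulf_neq0 // expf_neq0 // -a0.
by move/divr1_eq.
Qed.

End Poles.
End Argument.

(** * Conjugates and the norm of a unit *)

Lemma minpoly_dvd (R : realType) (z : R[i]) (p q : {poly rat}) :
  is_minpoly z p -> root (map_poly ratr q) z -> p %| q.
Proof.
case=> _ p_irr zp /rootP q0; apply: contraT.
(* Otherwise the irreducible [p] would be coprime to [q], also over [R[i]], and they could not share
   the root [z]. *)
rewrite -irreducible_poly_coprime // -(coprimep_map (@ratr R[i])).
by move/coprimep_root/(_ zp); rewrite q0 eqxx.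
Qed.

Section Conjugates.
Variables (R : realType) (z : R[i]) (p : {poly rat}).
Hypothesis zp : is_minpoly z p.

Lemma conjugate_root (y : R[i]) : conjugate_of z y -> root (map_poly ratr p) y.
Proof.
case=> p' zp'; apply: root_dvdp; rewrite dvdp_map.
by apply: minpoly_dvd zp' _; case: zp.
Qed.

(** If 0 were a root of [p], then X would divide the irreducible [p], so [p] would be associate to X
    and [z] would be 0. *)
Lemma conjugate_neq0 (y : R[i]) : z != 0 -> conjugate_of z y -> y != 0.
Proof.
move=> z0 /conjugate_root yp; apply: contraNneq z0 => y0.
case: zp yp => _ [_ p_irr] zp0; rewrite {}y0 rootE horner_coef0 coef_map.
rewrite fmorph_eq0 -horner_coef0 -rootE -dvdp_XsubCl => /p_irr.
rewrite size_XsubC => /(_ isT) pX; move: zp0.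
rewrite -(eqp_root (p := map_poly ratr ('X - 0%:P))) ?eqp_map //.
by rewrite subr0 map_polyX rootX.
Qed.

(* Gauss's lemma *)
Lemma minpoly_dvd_int (q : {poly int}) : root (map_poly intr q) z ->
  exists (p1 r : {poly int}) (b : rat),
    [/\ q = p1 * r, p = b *: map_poly intr p1 & b * (lead_coef p1)%:~R = 1].
Proof.
move=> qz; have /(minpoly_dvd zp)/dvdpP_rat_int[p1 [b b0 pE] [r qE]] :
    root (map_poly ratr (map_poly intr q : {poly rat})) z.
  by rewrite -map_poly_comp (eq_map_poly (g := intr)) // => m; exact: ratr_int.
exists p1, r, b; split=> //; case: zp => /monicP + _ _.
by rewrite pE lead_coefZ lead_coef_map_inj //; exact: intr_inj.
Qed.

(** By Gauss's lemma, [p] is proportional to an integer factor [p1] of a monic equation of [z] and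
    to an integer factor [p2] of the reversed monic equation of 1/z. The former has leading
    coefficient 1 or -1, the latter constant coefficient 1 or -1. *)
Lemma minpoly_coef0_unit : algebraic_unit z -> p`_0 ^+ 2 = 1.
Proof.
case=> z0 [[q /monicP q1 qz] [q' /monicP q'1 q'z]].
have [p1 [r [b [qE pE lead_p]]]] := minpoly_dvd_int qz.
have := root_map_rev_poly (f := intr) z0 q'z.
move=> /minpoly_dvd_int[p2 [r' [b' [q'E pE' lead_p']]]].
have b1 : b ^+ 2 = 1.
  move: q1; rewrite qE lead_coefM => /sqr_eq1_of_mul_eq1 l1.
  rewrite -[LHS]mulr1 -[X in _ * X](rmorph1 intr) -l1 rmorphXn -exprMn lead_p.
  exact: expr1n.
have c1 : p2`_0 ^+ 2 = 1.
  by move: q'1; rewrite -coef0_rev_poly q'E coef0M => /sqr_eq1_of_mul_eq1.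
have pp : p`_0 ^+ 2 = (p1`_0 ^+ 2)%:~R.
  by rewrite pE coefZ coef_map exprMn b1 mul1r rmorphXn.
have : p`_0 ^+ 2 * ((lead_coef p2) ^+ 2)%:~R = 1.
  rewrite pE' coefZ coef_map exprMn mulrAC rmorphXn -exprMn lead_p' expr1n mul1r.
  by rewrite -rmorphXn c1.
rewrite pp -rmorphM => /(@intr_inj rat _ 1); rewrite -exprMn => /eqP.
rewrite sqrf_eq1 => /orP[] /eqP.
  by move/sqr_eq1_of_mul_eq1 ->.
by move/(congr1 -%R); rewrite opprK -mulrN => /sqr_eq1_of_mul_eq1 ->.
Qed.

End Conjugates.

(** The n + 1 distinct conjugates are all the roots of [p], whose constant coefficient is therefore
    their product up to sign; squaring removes the sign. *)
Lemma conjugate_prod_unit (R : realType) n (alpha : R) (a : 'I_n.+1 -> R[i]) :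
  has_degree alpha%:C n.+1 -> conjugate_numbering alpha a ->
  algebraic_unit alpha%:C -> (\prod_i a i) ^+ 2 = 1.
Proof.
case=> p pP sz_p [a_inj ran_a _] /(minpoly_coef0_unit pP) p0.
have [/monicP p1 _ _] := pP.
have ap i : root (map_poly ratr p) (a i).
  by apply: (conjugate_root pP); rewrite -ran_a; exists i.
have := @all_roots_prod_XsubC _ (map_poly ratr p) [seq a i | i <- enum 'I_n.+1].
rewrite size_map_poly sz_p size_map size_enum_ord uniq_rootsE.
rewrite map_inj_uniq ?enum_uniq // lead_coef_map p1 rmorph1 scale1r.
move=> /(_ erefl) /(_ _ isT) pE.
have {pE}/(congr1 (fun q : {poly R[i]} => q`_0 ^+ 2)) :
    map_poly ratr p = \prod_(w <- [seq a i | i <- enum 'I_n.+1]) ('X - w%:P).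
  by apply: pE; apply/allP => _ /mapP[i _ ->].
rewrite coef_map coef0_prod_XsubC -rmorphXn p0 rmorph1 exprMn sqrr_sign mul1r.
by rewrite big_map big_enum.
Qed.

(** * Injectivity of the enumeration against triviality of the relations *)

Section Injectivity.
Variables (R : realType) (n : nat) (alpha : R) (a : 'I_n.+1 -> R[i]).
Hypotheses (alpha1 : 1 < alpha) (a_neq0 : forall i, a i != 0).
Hypothesis (a0 : a ord0 = alpha%:C).

Lemma pole_inj : trivial_relations a -> injective (pole alpha a).
Proof.
move=> triv k k' /(pole_eq_relation alpha1 a_neq0 _ _ a0)/triv[e _] mE.
have sumE : (\sum_j k' j)%N%:Z - (\sum_j k j)%N%:Z = e.
  move/rowP/(_ ord0): mE; rewrite mxE unlift_none => <-.
  by rewrite -scaler_int !mxE mulr1 intz.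
have kE j : (k j)%:Z - (k' j)%:Z = e.
  move/rowP/(_ (lift ord0 j)): mE; rewrite mxE liftK => <-.
  by rewrite -scaler_int !mxE mulr1 intz.
suff e0 : e = 0.
  by apply/ffunP => j; have := kE j; rewrite e0 => /eqP; rewrite subr_eq0 => /eqP[].
(* This sum is also -e by [sumE], whence (n + 1) e = 0. *)
have : \sum_j ((k j)%:Z - (k' j)%:Z) = e *+ n.
  by under eq_bigr do rewrite kE; rewrite sumr_const card_ord.
rewrite sumrB -!(big_morph Posz PoszD erefl) -opprB sumE => /eqP.
by rewrite -subr_eq0 -opprD -mulrS oppr_eq0 mulrn_eq0 => /eqP.
Qed.

Let pospart (x : int) : nat := if x is Posz y then y else 0%N.

Let pospartB x : (pospart x)%:Z - (pospart (- x))%:Z = x.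
Proof. by case: x => [[]|] //= m; rewrite ?subr0 // NegzE sub0r. Qed.

(** The positive and negative parts of the exponents other than the first form two multi-indices. As
    the total is 0, the first exponent is the difference of their sizes, so their poles coincide. *)
Lemma relation_sum0_eq0 (m : 'rV[int]_n.+1) : injective (pole alpha a) ->
  relation_module a m -> \sum_i m ord0 i = 0 -> m = 0.
Proof.
move=> inj rel_m; rewrite big_ord_recl => sum0.
pose k : {ffun 'I_n -> nat} := [ffun j => pospart (m ord0 (lift ord0 j))].
pose k' : {ffun 'I_n -> nat} := [ffun j => pospart (- m ord0 (lift ord0 j))].
have kE j : (k j)%:Z - (k' j)%:Z = m ord0 (lift ord0 j).
  by rewrite !ffunE pospartB.
have m0E : (\sum_j k' j)%N%:Z - (\sum_j k j)%N%:Z = m ord0 ord0.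
  rewrite -opprB !(big_morph Posz PoszD erefl) -sumrB.
  under eq_bigr do rewrite kE.
  by apply/eqP; rewrite eq_sym -addr_eq0; apply/eqP.
have kk' : k = k'.
  apply/inj/(pole_eq_relation alpha1 a_neq0 _ _ a0); rewrite (_ : \row_i _ = m) //.
  by apply/rowP => i; rewrite mxE; case: unliftP => [j|] ->.
apply/rowP => i; rewrite mxE; case: (unliftP ord0 i) => [j|] ->.
  by rewrite -kE kk' subrr.
by rewrite -m0E kk' subrr.
Qed.

(* As the product of the conjugates is 1 or -1, a relation m yields the relation
   2 r m - 2 (m_1 + ... + m_r) e, whose exponents sum to 0. *)
Lemma trivial_relations_of_inj : (\prod_i a i) ^+ 2 = 1 ->
  injective (pole alpha a) -> trivial_relations a.
Proof.
move=> norm1 inj m rel_m; pose s := \sum_i m ord0 i.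
pose m' : 'rV[int]_n.+1 := \row_i (m ord0 i * (2 * n.+1%:Z) - 2 * s).
have rel_m' : relation_module a m'.
  have prodXz k (F : 'I_n.+1 -> R[i]) : \prod_i F i ^ k = (\prod_i F i) ^ k.
    by rewrite (big_morph (fun x => x ^ k) (fun x y => expfzMl x y k) (exp1rz _ k)).
  rewrite /relation_module /=.
  under eq_bigr do rewrite mxE expfzDr // -invr_expz -exprz_exp.
  rewrite prodf_div !prodXz -[_ ^ (2 * s)]exprz_exp rel_m.
  by rewrite [(\prod_i a i) ^ _]norm1 !exp1rz divr1.
have m'0 : m' = 0.
  apply: relation_sum0_eq0 => //.
  under eq_bigr do rewrite mxE.
  by rewrite sumrB -mulr_suml -/s sumr_const card_ord; lia.
(* The vanishing of [m'] makes all exponents of [m] equal, so the first one can serve as the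
   multiple of (1, ..., 1). *)
have mE i : m ord0 i * n.+1%:Z = s.
  by move/rowP/(_ i): m'0; rewrite !mxE; lia.
exists (m ord0 ord0) => //; apply/rowP => i.
rewrite -scaler_int !mxE mulr1 intz; apply: (mulIf (x := n.+1%:Z)) => //.
by rewrite !mE.
Qed.

End Injectivity.

Theorem theorem4p8 (R : realType) (n : nat) (alpha : R) (a : 'I_n.+1 -> R[i])
    (palpha : perron alpha) (degalpha : has_degree alpha%:C n.+1)
    (numa : conjugate_numbering alpha a) :
  (trivial_relations a -> injective (pole_enumeration palpha a)) /\
  (algebraic_unit alpha%:C ->
     (trivial_relations a <-> injective (pole_enumeration palpha a))).
Proof.
have alpha1 := perron_gt1 palpha.
have [_ ran_a a0] := numa.
have a_neq0 i : a i != 0.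
  have [p pP _] := degalpha; apply: (conjugate_neq0 pP).
    by rewrite (fmorph_eq0 (real_complex R)) gt_eqF // (lt_trans ltr01).
  by rewrite -ran_a; exists i.
have injE : injective (pole_enumeration palpha a) <-> injective (pole alpha a).
  split=> inj k k'; last by move=> /(congr1 val); exact: inj.
  by move=> E; apply: inj; apply: val_inj.
have triv_inj : trivial_relations a -> injective (pole_enumeration palpha a).
  by move=> triv; apply/injE; exact: pole_inj.
split=> // unit_alpha; split=> // /injE.
exact/trivial_relations_of_inj/(conjugate_prod_unit degalpha).
Qed.
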